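(* Let $(\mathcal{E},\mathcal{D}(\mathcal{E}))$ be a regular, irreducible, transient Dirichlet form on $L^2(E;m)$, and let $\mu$ be a positive smooth Radon measure on $E$ such that the form $\mathcal{E}^\mu(u,v)=\mathcal{E}(u,v)-\int_Euv\,d\mu$ on $\mathcal{D}(\mathcal{E})\cap C_0(E)$ is positive semi-definite and closable in $L^2(E;m)$, with closure $(\mathcal{E}^\mu,\mathcal{D}(\mathcal{E}^\mu))$. Suppose $\mathcal{H}^+(\mu)$ is not empty. If $(\mathcal{E}^{\mu,h},\mathcal{D}(\mathcal{E}^{\mu,h}))$ is transient for some $h\in\mathcal{H}^+(\mu)$, then it is transient for every $h\in\mathcal{H}^+(\mu)$.
   Context: $E$ is a locally compact separable metric space, $m$ a positive Radon measure on $E$ with full topological support, $C_0(E)$ the continuous functions with compact support; $a(u)=a(u,u)$. Irreducible: if a measurable $A\subset E$ satisfies $T_t(1_Af)=1_AT_tf$ $m$-a.e. for all $f\in L^2(E;m)$, $t>0$ ($T_t$ the semigroup of $\mathcal{E}$), then $m(A)=0$ or $m(A^c)=0$. A Dirichlet form $(\mathcal{A},\mathcal{D}(\mathcal{A}))$ on $L^2(E;n)$ is transient if there is a bounded $g\in L^1(E;n)$, $g>0$ a.e., with $\int_E|u|g\,dn\le\sqrt{\mathcal{A}(u)}$ for all $u\in\mathcal{D}(\mathcal{A})$. A positive Borel measure is smooth if it charges no set of zero capacity and there are increasing closed sets $F_n$ with $\mu(F_n)<\infty$ and $\lim_n\mathrm{Cap}(K\setminus F_n)=0$ for every compact $K$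 (Cap is the 1-capacity of $\mathcal{E}$). $\{T^\mu_t\}$ is the $L^2(E;m)$-semigroup of $(\mathcal{E}^\mu,\mathcal{D}(\mathcal{E}^\mu))$; it is positivity preserving and is extended to non-negative measurable functions by monotone limits. $\mathcal{H}^+(\mu)=\{h:0<h<\infty\ m\text{-a.e.},\ T^\mu_th\le h\ m\text{-a.e. for all }t>0\}$. For $h\in\mathcal{H}^+(\mu)$, $(\mathcal{E}^{\mu,h},\mathcal{D}(\mathcal{E}^{\mu,h}))$ is the Dirichlet form on $L^2(E;h^2m)$ given by $\mathcal{E}^{\mu,h}(u,v)=\mathcal{E}^\mu(hu,hv)$, $\mathcal{D}(\mathcal{E}^{\mu,h})=\{u\in L^2(E;h^2m):hu\in\mathcal{D}(\mathcal{E}^\mu)\}$. *)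

(* Defs.v *)
From HB Require Import structures.
From mathcomp Require Import all_boot all_order all_algebra.
From mathcomp Require Import all_classical all_reals all_analysis measurable_realfun.

Set Implicit Arguments.
Unset Strict Implicit.
Unset Printing Implicit Defensive.

Import Order.TTheory GRing.Theory Num.Theory.
Import numFieldNormedType.Exports.

Local Open Scope classical_set_scope.
Local Open Scope ring_scope.

(* A metric space equipped with its Borel sigma-algebra. *)
HB.mixin Record isBorelSpace d T & Measurable d T & Topological T := {
  measurable_borel : @measurable d T = <<s @open T >>
}.

#[short(type="borelMetricType")]
HB.structure Definition BorelMetric d (R : realType) :=
  { T of Measurable d T & Metric R T & isBorelSpace d T }.

Definition separable (X : topologicalType) : Prop :=
  exists2 S : set X, countable S & dense S.

(* C_0(E): continuous functions with compact support. *)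
Definition C0 {R : realType} (X : topologicalType) : set (X -> R) :=
  [set f | continuous f /\ compact (closure [set x | f x != 0])].

Section borel_measures.
Local Open Scope ereal_scope.
Context {d : measure_display} {R : realType} {E : borelMetricType d R}.

Definition radon (mu : {measure set E -> \bar R}) : Prop :=
  [/\ forall K : set E, compact K -> mu K < +oo,
      forall A : set E, measurable A ->
        mu A = ereal_inf [set mu O | O in [set O | open O /\ A `<=` O]]
    & forall O : set E, open O ->
        mu O = ereal_sup [set mu K | K in [set K | compact K /\ K `<=` O]]].

Definition full_support (mu : {measure set E -> \bar R}) : Prop :=
  forall O : set E, open O -> O !=set0 -> 0 < mu O.

End borel_measures.

(* A bilinear form is a domain together with a function that is meaningful
   on that domain only. An element of L^2 is handled through its
   representatives T -> R; see [L2_form] for the compatibility with a.e.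
   equality. *)
Record bilform (T : Type) (R : realType) := BilForm {
  dom : set (T -> R);
  form_eval :> (T -> R) -> (T -> R) -> R
}.

Section L2.
Context {d : measure_display} {T : measurableType d} {R : realType}.
Variable m : {measure set T -> \bar R}.
Implicit Types (u v f g : T -> R) (F : bilform T R).

Definition L2dot u v : R := (\int[m]_x (u x * v x))%R.

Definition cvg_L2 {I : Type} (Flt : set_system I) (u_ : I -> T -> R) u : Prop :=
  ('N[m]_2%:E[EFin \o (u_ i - u)%R] @[i --> Flt] --> 0)%E.

Definition nonneg_form F : Prop := forall u, dom F u -> 0 <= F u u.

Definition symmetric_form F : Prop :=
  [/\ dom F 0,
      forall (a : R) u v, dom F u -> dom F v -> dom F (a *: u + v),
      forall u v, dom F u -> dom F v -> F u v = F v u,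
      forall (a : R) u v w, dom F u -> dom F v -> dom F w ->
        F (a *: u + v) w = a * F u w + F v w
    & nonneg_form F].

(* F is a form on (a subspace of) the space L^2(m) of a.e. classes. *)
Definition L2_form F : Prop :=
  (forall u, dom F u -> u \in Lfun m 2%:E) /\
  (forall u v, dom F u -> v \in Lfun m 2%:E -> u = v %[ae m] ->
     dom F v /\ forall w, dom F w -> F u w = F v w).

Definition densely_defined F : Prop :=
  forall f (e : R), f \in Lfun m 2%:E -> 0 < e ->
    exists2 u, dom F u & ('N[m]_2%:E[EFin \o (f - u)%R] < e%:E)%E.

Definition form1 F u v : R := F u v + L2dot u v.

Definition cauchy_for (q : (T -> R) -> (T -> R) -> R) (u_ : nat -> T -> R) :
    Prop :=
  forall e : R, 0 < e -> \forall n & k \near \oo, q (u_ n - u_ k) (u_ n - u_ k) < e.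

Definition closed_form F : Prop :=
  forall u_ : nat -> T -> R, (forall n, dom F (u_ n)) ->
    cauchy_for (form1 F) u_ ->
    exists2 u, dom F u & form1 F (u_ n - u) (u_ n - u) @[n --> \oo] --> 0.

Definition markovian F : Prop :=
  forall u, dom F u ->
    let v := fun x => Num.min (Num.max (u x) 0) 1 in
    dom F v /\ F v v <= F u u.

Definition dirichlet_form F : Prop :=
  [/\ symmetric_form F, L2_form F, densely_defined F, closed_form F
    & markovian F].

Definition transient F : Prop :=
  exists g : T -> R,
    [/\ exists C : R, forall x, `|g x| <= C,
        g \in Lfun m 1%:E,
        {ae m, forall x, 0 < g x}
      & forall u, dom F u ->
          (\int[m]_x (`|u x| * g x)%:E <= (Num.sqrt (F u u))%:E)%E].

Definition closable F : Prop :=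
  forall u_ : nat -> T -> R, (forall n, dom F (u_ n)) ->
    cauchy_for F u_ -> cvg_L2 \oo u_ 0 ->
    F (u_ n) (u_ n) @[n --> \oo] --> 0.

Definition approx_seq F (u_ : nat -> T -> R) u : Prop :=
  [/\ forall n, dom F (u_ n), cauchy_for F u_, u \in Lfun m 2%:E
    & cvg_L2 \oo u_ u].

(* For a closable form the limit below exists and does not depend on the
   approximating sequences. *)
Definition form_closure F : bilform T R :=
  BilForm [set u | exists u_ : nat -> T -> R, approx_seq F u_ u]
          (fun u v => xget 0 [set l : R | exists u_ v_ : nat -> T -> R,
             [/\ approx_seq F u_ u, approx_seq F v_ v
               & F (u_ n) (v_ n) @[n --> \oo] --> l]]).

(* Strongly continuous semigroup of symmetric contractions of L^2(m), acting
   on representatives; P t is relevant for t > 0 only. *)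
Definition L2_semigroup (P : R -> (T -> R) -> (T -> R)) : Prop :=
  (forall (t : R) f, 0 < t -> f \in Lfun m 2%:E -> P t f \in Lfun m 2%:E) /\
  [/\ forall (t : R) f g, 0 < t -> f \in Lfun m 2%:E -> g \in Lfun m 2%:E ->
        f = g %[ae m] -> P t f = P t g %[ae m],
      forall (t a : R) f g, 0 < t -> f \in Lfun m 2%:E -> g \in Lfun m 2%:E ->
        P t (a *: f + g) = a *: P t f + P t g %[ae m],
      forall (t : R) f g, 0 < t -> f \in Lfun m 2%:E -> g \in Lfun m 2%:E ->
        L2dot (P t f) g = L2dot f (P t g)
    & forall (t : R) f, 0 < t -> f \in Lfun m 2%:E ->
        ('N[m]_2%:E[EFin \o P t f] <= 'N[m]_2%:E[EFin \o f])%E] /\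
  (forall (s t : R) f, 0 < s -> 0 < t -> f \in Lfun m 2%:E ->
     P (s + t) f = P s (P t f) %[ae m]) /\
  (forall f, f \in Lfun m 2%:E -> cvg_L2 0^'+ (P ^~ f) f).

(* [semigroup_generator P u f]: u is in the domain of the generator A of P
   and A u = f. *)
Definition semigroup_generator (P : R -> (T -> R) -> (T -> R)) u f : Prop :=
  [/\ u \in Lfun m 2%:E, f \in Lfun m 2%:E
    & cvg_L2 0^'+ (fun t => t^-1 *: (P t u - u)) f].

(* [form_generator F u f]: u is in the domain of the self-adjoint operator A
   with F(u, v) = (- A u, v), and A u = f. *)
Definition form_generator F u f : Prop :=
  [/\ dom F u, f \in Lfun m 2%:E
    & forall v, dom F v -> F u v = - L2dot f v].

Definition semigroup_of F (P : R -> (T -> R) -> (T -> R)) : Prop :=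
  L2_semigroup P /\
  forall u f, semigroup_generator P u f <-> form_generator F u f.

Definition irreducible (P : R -> (T -> R) -> (T -> R)) : Prop :=
  forall A : set T, measurable A ->
    (forall f (t : R), f \in Lfun m 2%:E -> 0 < t ->
       P t (\1_A \* f) = \1_A \* P t f %[ae m]) ->
    m A = 0%E \/ m (~` A) = 0%E.

(* g is the image of f >= 0 under the extension of Q by monotone limits. *)
Definition monotone_ext (Q : (T -> R) -> (T -> R)) (f g : T -> \bar R) : Prop :=
  exists f_ : nat -> T -> R,
    [/\ forall n, f_ n \in Lfun m 2%:E,
        {ae m, forall x, forall n, 0 <= f_ n x <= f_ n.+1 x},
        {ae m, forall x, (f_ n x)%:E @[n --> \oo] --> f x}
      & {ae m, forall x, (Q (f_ n) x)%:E @[n --> \oo] --> g x}].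

Definition Hplus (P : R -> (T -> R) -> (T -> R)) : set {mfun T >-> \bar R} :=
  [set h | {ae m, forall x, (0 < h x < +oo)%E} /\
     forall t : R, 0 < t -> exists2 g, monotone_ext (P t) h g &
       {ae m, forall x, (g x <= h x)%E}].

End L2.

Section square_density.
Context {d : measure_display} {T : measurableType d} {R : realType}.
Variables (m : {measure set T -> \bar R}) (h : {mfun T >-> \bar R}).

Definition hsq_measure (A : set T) : \bar R :=
  (\int[m]_(x in A) (h x * h x))%E.

Let hsq_ge0 x : (0 <= h x * h x)%E.
Proof. by rewrite -expe2 sqre_ge0. Qed.

Let hsq_measure0 : hsq_measure set0 = 0%E.
Proof. by rewrite /hsq_measure integral_set0. Qed.

Let hsq_measure_ge0 A : (0 <= hsq_measure A)%E.
Proof. by apply: integral_ge0. Qed.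

Let hsq_measure_sigma_additive : semi_sigma_additive hsq_measure.
Proof.
move=> /= A mA tA mUA; rewrite /hsq_measure ge0_integral_bigcup//.
  by apply: is_cvg_ereal_nneg_natsum_cond => n _ _; exact: integral_ge0.
by apply: measurable_funTS; exact: emeasurable_funM.
Qed.

HB.instance Definition _ := isMeasure.Build _ _ _ hsq_measure
  hsq_measure0 hsq_measure_ge0 hsq_measure_sigma_additive.

End square_density.

Section h_transform.
Context {d : measure_display} {T : measurableType d} {R : realType}.
Variables (m : {measure set T -> \bar R}) (h : {mfun T >-> \bar R}).

(* Since 0 < h < +oo a.e., [fine] only affects a null set. *)
Definition h_form (F : bilform T R) : bilform T R :=
  let hmul (u : T -> R) : T -> R := fun x => fine (h x) * u x in
  BilForm [set u | u \in Lfun (hsq_measure m h) 2%:E /\ dom F (hmul u)]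
          (fun u v => F (hmul u) (hmul v)).

End h_transform.

Section potential_theory.
Context {d : measure_display} {R : realType} {E : borelMetricType d R}.
Variable m : {measure set E -> \bar R}.
Implicit Types F : bilform E R.

Definition regular F : Prop :=
  (forall u (e : R), dom F u -> 0 < e ->
     exists2 v, (dom F `&` @C0 R E) v & form1 m F (u - v) (u - v) < e) /\
  (forall f (e : R), @C0 R E f -> 0 < e ->
     exists2 v, (dom F `&` @C0 R E) v & forall x, `|f x - v x| < e).

Definition cap_open F (O : set E) : \bar R :=
  ereal_inf [set (form1 m F u u)%:E | u in
    [set u | dom F u /\ {ae m, forall x, O x -> 1 <= u x}]].

Definition cap F (A : set E) : \bar R :=
  ereal_inf [set cap_open F O | O in [set O | open O /\ A `<=` O]].

Definition smooth F (mu : {measure set E -> \bar R}) : Prop :=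
  (forall A : set E, measurable A -> cap F A = 0%E -> mu A = 0%E) /\
  exists F_ : nat -> set E,
    [/\ {homo F_ : n k / (n <= k)%N >-> n `<=` k},
        forall n, closed (F_ n),
        forall n, (mu (F_ n) < +oo)%E
      & forall K, compact K -> (cap F (K `\` F_ n) @[n --> \oo] --> 0)%E].

(* The form F(u, v) - \int u v dmu on D(F) `&` C_0(E). *)
Definition perturbed_form F (mu : {measure set E -> \bar R}) : bilform E R :=
  BilForm (dom F `&` @C0 R E)
          (fun u v => F u v - (\int[mu]_x (u x * v x))%R).

End potential_theory.

(* Main.v *)
(* Writing w = h u turns the transience inequality of the h-transform into
   \int |w| g h dm <= sqrt (Fmu w w) for all w in the domain of Fmu, in which
   only the weight g h depends on h. Given a weight g1 for h1, the function
   g2 = g1 * min (1, (h1 / h2)^2) is thus a weight for h2: it is bounded by g1,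
   g2 h2^2 <= g1 h1^2 gives integrability, and g2 h2 <= g1 h1 the inequality. *)
Require Import Defs.
From mathcomp Require Import all_boot all_order all_algebra.
From mathcomp Require Import all_classical all_reals all_analysis measurable_realfun ring.

Set Implicit Arguments.
Unset Strict Implicit.
Unset Printing Implicit Defensive.

Import Order.TTheory GRing.Theory Num.Theory.
Import numFieldNormedType.Exports.

Local Open Scope classical_set_scope.
Local Open Scope ring_scope.

(** * Null sets, integrals and L2 norms for the measure with density h^2 *)

Section square_density.
Context {d : measure_display} {T : measurableType d} {R : realType}.
Variables (m : {measure set T -> \bar R}) (h : {mfun T >-> \bar R}).

Let measurable_sq : measurable_fun setT (fun x => h x * h x)%E.
Proof. exact: emeasurable_funM. Qed.

Let sq_ge0 x : (0 <= h x * h x)%E.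
Proof. by rewrite -expe2 sqre_ge0. Qed.

Hypothesis h_gt0 : {ae m, forall x, (0 < h x < +oo)%E}.

(** If h^2 integrates to 0 over N, then h^2 = 0 a.e. on N; since h > 0 a.e., N must be null. Hence
    a.e. statements can be moved between m and h^2 m, and so between two choices of h. *)
Lemma hsq_measure_eq0 (N : set T) : measurable N ->
  hsq_measure m h N = 0%E <-> m N = 0%E.
Proof.
move=> mN.
have mhN : measurable_fun N (fun x => h x * h x)%E by exact: measurable_funTS.
have hsqE : hsq_measure m h N = (\int[m]_(x in N) `|h x * h x|)%E.
  by apply: eq_integral => x _; rewrite gee0_abs.
split=> [hN|mN0]; last by rewrite hsqE integral_abs_eq0.
apply/negligibleP => //.
have /ae_eq_integral_abs : (\int[m]_(x in N) `|h x * h x|)%E = 0%E.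
  by rewrite -hsqE.
move=> /(_ mN mhN) hN0.
suff : {ae m, forall x, ~ N x}.
  by apply: negligibleS => x /= Nx; exact.
apply: filterS2 hN0 h_gt0 => x + /andP[h0 _] Nx => /(_ Nx)/eqP.
by rewrite /= mule_eq0 orbb gt_eqF.
Qed.

Lemma ae_hsq_measure (A : set T) :
  {ae hsq_measure m h, forall x, A x} <-> {ae m, forall x, A x}.
Proof.
by split=> -[N [mN N0 subN]]; exists N; split=> //; apply/hsq_measure_eq0.
Qed.

Import HBNNSimple.

(** Standard extension from indicators to simple functions to monotone limits. The density is
    written with [fine] so that it is real and non-negative everywhere; this changes it on a null
    set only. *)
Lemma ge0_integral_hsq_measure (f : T -> \bar R) :
  measurable_fun setT f -> (forall x, 0 <= f x)%E ->
  (\int[hsq_measure m h]_x f x =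
   \int[m]_x (f x * (`|fine (h x)| ^+ 2)%:E))%E.
Proof.
move=> mf f0; pose k x := `|fine (h x)| ^+ 2.
have mk : measurable_fun setT (EFin \o k).
  apply/measurable_EFinP/measurable_funX/measurableT_comp => //.
  exact: measurableT_comp (fine_measurable measurableT) _.
have k0 x : (0 <= (k x)%:E)%E by rewrite lee_fin exprn_ge0.
have hsqE A : measurable A -> hsq_measure m h A = (\int[m]_(x in A) (k x)%:E)%E.
  move=> mA; apply: ge0_ae_eq_integral => //.
  - exact: measurable_funTS.
  - exact: measurable_funTS.
  - apply: filterS h_gt0 => x /andP[hx0 hxoo] _.
    rewrite /k real_normK ?num_real// -[h x]fineK ?expr2 ?EFinM//.
    by rewrite ge0_fin_numE// ltW.
pose f_ := nnsfun_approx measurableT mf.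
have f_nd x : {homo (fun n => f_ n x) : n p / (n <= p)%N >-> n <= p}.
  by move=> a b ab; exact/lefP/nd_nnsfun_approx.
have cvg_f x : (f_ n x)%:E @[n --> \oo] --> f x.
  exact: (cvg_nnsfun_approx measurableT mf).
(* Monotone convergence on both sides reduces the claim to the simple functions [f_ n]. *)
transitivity (limn (fun n => \int[hsq_measure m h]_x (f_ n x)%:E)%E).
  rewrite -monotone_convergence//.
  - by apply: eq_integral => x _; apply/esym/cvg_lim.
  - by move=> n; exact/measurable_EFinP/measurable_funP.
  - by move=> n x _; rewrite lee_fin.
  - by move=> x _ a b ab; rewrite lee_fin f_nd.
transitivity (limn (fun n => \int[m]_x ((f_ n x)%:E * (k x)%:E))%E); last first.
  rewrite -monotone_convergence//.
  - apply: eq_integral => x _; apply/cvg_lim => //.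
    by apply: cvgeZr; [by []|exact: cvg_f].
  - move=> n; apply: emeasurable_funM; last exact: mk.
    exact/measurable_EFinP/measurable_funP.
  - by move=> n x _; rewrite mule_ge0// lee_fin.
  - by move=> x _ a b ab; rewrite lee_wpmul2r// lee_fin f_nd.
congr (lim (_ @ \oo)); apply/funext => n.
have mind r : measurable_fun setT (fun x => (r * \1_(f_ n @^-1` [set r]) x)%:E).
  by apply/measurable_EFinP/measurable_funM.
(* Write [f_ n] as the finite sum, over its values y, of y times the indicator of its level set, and
   compare the two integrals term by term. *)
transitivity (\int[hsq_measure m h]_x
    (\sum_(y \in range (f_ n)) (y * \1_(f_ n @^-1` [set y]) x)%:E))%E.
  by apply: eq_integral => x _; rewrite [in LHS](fimfunE (f_ n) x) -fsumEFin.
rewrite ge0_integral_fsum//; last by move=> y x _; exact: nnfun_muleindic_ge0.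
transitivity (\int[m]_x
    (\sum_(y \in range (f_ n)) ((y * \1_(f_ n @^-1` [set y]) x)%:E * (k x)%:E)))%E;
  last first.
  apply: eq_integral => x _; rewrite -ge0_mule_fsuml; last first.
    by move=> y; exact: nnfun_muleindic_ge0.
  by rewrite fsumEFin// -(fimfunE (f_ n) x).
rewrite ge0_integral_fsum//; last 2 first.
- by move=> y; exact: emeasurable_funM.
- by move=> y x _; rewrite mule_ge0// nnfun_muleindic_ge0.
apply: eq_fsbigr => r; rewrite inE => -[x0 _ /= rE].
have r0 : 0 <= r by rewrite -rE.
have mA : measurable (f_ n @^-1` [set r]) by [].
rewrite integralZl_indic_nnsfun//.
rewrite integral_indic// setIT [X in (_ * X)%E]hsqE//.
transitivity (\int[m]_x (r%:E * ((\1_(f_ n @^-1` [set r]) x)%:E * (k x)%:E)))%E;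
  last by apply: eq_integral => x _; rewrite muleA.
rewrite ge0_integralZl//; last 2 first.
- by apply: emeasurable_funM => //; exact/measurable_EFinP.
- by move=> x _; rewrite mule_ge0// lee_fin.
congr (_ * _)%E; rewrite [LHS]integral_mkcond.
apply: eq_integral => x _; rewrite patchE indicE.
by case: ifPn; rewrite ?mul1e ?mul0e.
Qed.

(** Multiplication by h is an isometry from L2(h^2 m) into L2(m); this turns square integrability of
    h v into that of v. *)
Lemma Lnorm2_hsq_measure (v : T -> R) : measurable_fun setT v ->
  'N[hsq_measure m h]_2%:E[EFin \o v]%E =
  'N[m]_2%:E[EFin \o (fun x => fine (h x) * v x)%R]%E.
Proof.
move=> mv; rewrite unlock /=; congr (_ `^ _)%E.
have sqE (a : R) : (`|a| `^ 2 = a ^+ 2)%R.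
  by rewrite powR_mulrn// real_normK ?num_real.
rewrite ge0_integral_hsq_measure; last 2 first.
- apply/measurable_EFinP; under eq_fun do rewrite sqE.
  exact: measurable_funX.
- by move=> x; rewrite lee_fin powR_ge0.
apply: eq_integral => x _.
by rewrite !sqE -EFinM real_normK ?num_real// exprMn mulrC.
Qed.

End square_density.

(** * Measurability, and invariance of the closure of a form under a.e. equality *)

Lemma measurable_fine_mfun {d : measure_display} {T : measurableType d}
    {R : realType} (h : {mfun T >-> \bar R}) :
  measurable_fun setT (fun x => fine (h x)).
Proof. exact: measurableT_comp (fine_measurable measurableT) _. Qed.

Lemma measurable_mfun_Lfun {d : measure_display} {T : measurableType d}
    {R : realType} (m : {measure set T -> \bar R}) (p : \bar R) (u : T -> R) :
  u \in Lfun m p -> measurable_fun setT u.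
Proof. by move/sub_Lfun_mfun; rewrite inE. Qed.

Lemma eq_ae_Lnorm {d : measure_display} {T : measurableType d} {R : realType}
    (m : {measure set T -> \bar R}) (r : R) (f g : T -> R) :
  measurable_fun setT f -> measurable_fun setT g -> f = g %[ae m] ->
  'N[m]_r%:E[EFin \o f]%E = 'N[m]_r%:E[EFin \o g]%E.
Proof.
move=> mf mg fg; rewrite unlock /=; congr (_ `^ _)%E.
have mpow (u : T -> R) : measurable_fun setT u ->
    measurable_fun setT (fun x => (`|u x| `^ r)%:E).
  move=> mu; apply/measurable_EFinP.
  by apply: (measurableT_comp (measurable_powR r)); exact: measurableT_comp.
apply: ge0_ae_eq_integral => //; try exact: mpow.
by apply: filterS fg => x fgx _; rewrite /= fgx.
Qed.

Section closure_ae.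
Context {d : measure_display} {T : measurableType d} {R : realType}.
Variables (m : {measure set T -> \bar R}) (F : bilform T R).
Hypothesis dom_L2 : forall u, dom F u -> u \in Lfun m 2%:E.
Variables u v : T -> R.
Hypotheses (u_L2 : u \in Lfun m 2%:E) (v_L2 : v \in Lfun m 2%:E).
Hypothesis uv : u = v %[ae m].

(** The limit of an approximating sequence enters only through L2 membership and the norms of
    [u_ n - u], which are the same for every representative of the class. *)
Lemma approx_seq_ae : approx_seq m F ^~ u = approx_seq m F ^~ v.
Proof.
suff NE u_ : (forall n, dom F (u_ n)) -> cvg_L2 m \oo u_ u = cvg_L2 m \oo u_ v.
  by apply/funext => u_; apply/propext; split=> -[du cu _ uu]; split=> //;
    [rewrite -NE|rewrite NE].
move=> du; suff NE : (fun n => 'N[m]_2%:E[EFin \o (u_ n - u)%R])%E =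
    (fun n => 'N[m]_2%:E[EFin \o (u_ n - v)%R])%E by rewrite /cvg_L2 NE.
apply/funext => n; apply: eq_ae_Lnorm.
- apply: measurable_funB; first exact: measurable_mfun_Lfun (dom_L2 (du n)).
  exact: measurable_mfun_Lfun u_L2.
- apply: measurable_funB; first exact: measurable_mfun_Lfun (dom_L2 (du n)).
  exact: measurable_mfun_Lfun v_L2.
- by apply: filterS uv => x uvx Tx; rewrite /= !fctE uvx.
Qed.

Lemma form_closure_ae : dom (form_closure m F) u ->
  dom (form_closure m F) v /\ form_closure m F u u = form_closure m F v v.
Proof.
have appE u_ : approx_seq m F u_ u = approx_seq m F u_ v.
  exact: (congr1 (fun S => S u_) approx_seq_ae).
move=> [u_ au]; split; first by exists u_; rewrite -appE.
(* The sets of limits from which [xget] chooses coincide, so the chosen values do. *)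
rewrite /=; congr (xget _ _); apply/seteqP; split=> l -[a [b [a1 b1 ab]]];
  by exists a, b; rewrite ?appE -?appE in a1 b1 *.
Qed.

End closure_ae.

(** * Transfer of transience from one h-transform to another *)

Section h_transform_transience.
Context {d : measure_display} {T : measurableType d} {R : realType}.
Variables (m : {measure set T -> \bar R}) (F : bilform T R).
Hypothesis dom_L2 : forall u, dom F u -> u \in Lfun m 2%:E.
Hypothesis form_ae : forall u v, dom F u -> v \in Lfun m 2%:E ->
  u = v %[ae m] -> dom F v /\ F u u = F v v.

(** The inequality for h2 at u is the one for h1 at v = h2 u / h1. As h1 v = h2 u holds only a.e.,
    [form_ae] is what identifies the two energies. *)
Lemma transient_h_form (h1 h2 : {mfun T >-> \bar R}) :
  {ae m, forall x, (0 < h1 x < +oo)%E} ->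
  {ae m, forall x, (0 < h2 x < +oo)%E} ->
  transient (hsq_measure m h1) (h_form m h1 F) ->
  transient (hsq_measure m h2) (h_form m h2 F).
Proof.
move=> h1_gt0 h2_gt0 [g [[C gC] gL1 g_gt0 gF]].
pose k1 x := `|fine (h1 x)|; pose k2 x := `|fine (h2 x)|.
have hfine_gt0 (h : {mfun T >-> \bar R}) x :
    (0 < h x < +oo)%E -> 0 < fine (h x).
  by move=> hx; exact: fine_gt0.
have mk1 : measurable_fun setT k1.
  by apply: measurableT_comp => //; exact: measurable_fine_mfun.
have mk2 : measurable_fun setT k2.
  by apply: measurableT_comp => //; exact: measurable_fine_mfun.
have mg : measurable_fun setT g := measurable_mfun_Lfun gL1.
have mV (k : T -> R) : measurable_fun setT k ->
    measurable_fun setT (fun x => k x `^ (-1)).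
  by move=> mk; exact: (measurableT_comp (measurable_powR (-1))).
(* [powR] because its measurability is in the library, unlike that of [^-1]. *)
pose r x := k1 x * k2 x `^ (-1).
have rE x : r x = k1 x / k2 x by rewrite /r powR_inv1 ?normr_ge0.
pose s x := Num.min 1 (r x ^+ 2).
have ms : measurable_fun setT s.
  apply: measurable_minr => //; apply: measurable_funX.
  by apply: measurable_funM => //; exact: mV.
have s01 x : 0 <= s x <= 1 by rewrite le_min ler01 sqr_ge0 ge_min lexx.
have s_ge0 x : 0 <= s x by case/andP: (s01 x).
have mag : measurable_fun setT (fun x => `|g x|) by exact: measurableT_comp.
have mags : measurable_fun setT (fun x => `|g x| * s x).
  exact: measurable_funM.
have mksq (k : T -> R) : measurable_fun setT k ->
    measurable_fun setT (fun x => (k x ^+ 2)%:E).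
  by move=> mk; apply/measurable_EFinP; exact: measurable_funX.
(* The absolute value makes the weight non-negative everywhere, [g] being positive only a.e. *)
exists (fun x => `|g x| * s x); split.
- exists C => x; rewrite normrM normr_id (ger0_norm (s_ge0 x)).
  by case/andP: (s01 x) => _ s1; rewrite (le_trans _ (gC x))// ler_piMr.
- apply/Lfun1_integrable/integrableP; split.
    exact/measurable_EFinP.
  move/Lfun1_integrable/integrableP : gL1 => [_ /=]; apply: le_lt_trans.
  have mEg : measurable_fun setT (fun x => `|g x|%:E).
    exact/measurable_EFinP.
  have mEgs : measurable_fun setT (fun x => (`| `|g x| * s x |)%:E).
    by apply/measurable_EFinP; exact: measurableT_comp.
  rewrite !ge0_integral_hsq_measure//.
  apply: ge0_le_integral => //.
  + by apply: emeasurable_funM => //; exact: mksq.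
  + by apply: emeasurable_funM => //; exact: mksq.
  + move=> x _; rewrite -!EFinM lee_fin normrM normr_id (ger0_norm (s_ge0 x)).
    rewrite -mulrA ler_wpM2l// -/(k1 x) -/(k2 x).
    (* Where [k2 x] is 0, so is [r x], and k1 = r k2 may fail; but there the left-hand side
       vanishes. *)
    have [k20|k20] := eqVneq (k2 x) 0.
      by rewrite k20 expr0n mulr0 sqr_ge0.
    have -> : k1 x ^+ 2 = r x ^+ 2 * k2 x ^+ 2.
      by rewrite rE -exprMn divfK.
    by rewrite ler_wpM2r ?sqr_ge0// ge_min lexx orbT.
- apply/ae_hsq_measure => //.
  move/(ae_hsq_measure h1_gt0) : g_gt0 => g_gt0.
  near=> x.
  have h1x : 0 < fine (h1 x) by apply: hfine_gt0; near: x.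
  have h2x : 0 < fine (h2 x) by apply: hfine_gt0; near: x.
  rewrite mulr_gt0//; first by rewrite normr_gt0 gt_eqF//; near: x.
  by rewrite lt_min ltr01 exprn_gt0// rE divr_gt0// normr_gt0 gt_eqF.
move=> u [uL2 du]; pose w x := fine (h2 x) * u x.
have mu : measurable_fun setT u := measurable_mfun_Lfun uL2.
have mw : measurable_fun setT w.
  by apply: measurable_funM => //; exact: measurable_fine_mfun.
pose v x := w x * k1 x `^ (-1).
have mv : measurable_fun setT v by apply: measurable_funM => //; exact: mV.
have wv : w = (fun x => fine (h1 x) * v x) %[ae m].
  apply: filterS h1_gt0 => x /hfine_gt0 h1x _.
  rewrite /v powR_inv1 ?normr_ge0// /k1 (gtr0_norm h1x) mulrCA divff ?mulr1//.
  by rewrite gt_eqF.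
have mhv : measurable_fun setT (fun x => fine (h1 x) * v x).
  by apply: measurable_funM => //; exact: measurable_fine_mfun.
(* h1 v inherits the finite norm of w = h2 u, to which it is a.e. equal. *)
have hvL2 : (fun x => fine (h1 x) * v x) \in Lfun m 2%:E.
  have /andP[_] := dom_L2 du; rewrite inE /= /finite_norm => wfin.
  apply/andP; split; rewrite inE//=.
  by rewrite /finite_norm -(eq_ae_Lnorm 2 mw mhv wv).
have [dv Fwv] := form_ae du hvL2 wv.
have vL2 : v \in Lfun (hsq_measure m h1) 2%:E.
  move: hvL2 => /andP[_]; rewrite inE /= /finite_norm => vfin.
  apply/andP; split; rewrite inE//=.
  by rewrite /finite_norm Lnorm2_hsq_measure.
rewrite /= Fwv; apply: le_trans (gF v (conj vL2 dv)).
have mvg : measurable_fun setT (fun x => (`|v x| * `|g x|)%:E).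
  by apply/measurable_EFinP/measurable_funM; exact: measurableT_comp.
have mug : measurable_fun setT (fun x => (`|u x| * (`|g x| * s x))%:E).
  by apply/measurable_EFinP/measurable_funM => //; exact: measurableT_comp.
(* With [|g x|] for [g x] the integrand is non-negative everywhere, so both integrals can be
   rewritten over m. *)
rewrite [leRHS](_ : _ = \int[hsq_measure m h1]_x (`|v x| * `|g x|)%:E)%E;
    last first.
  apply: ae_eq_integral => //.
    by apply/measurable_EFinP/measurable_funM => //; exact: measurableT_comp.
  by apply: filterS g_gt0 => x gx _; rewrite (gtr0_norm gx).
rewrite !ge0_integral_hsq_measure//; last first.
  by move=> x; rewrite lee_fin !mulr_ge0 ?exprn_ge0.
apply: ae_ge0_le_integral => //.
- by move=> x _; rewrite -EFinM lee_fin !mulr_ge0 ?exprn_ge0.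
- by apply: emeasurable_funM => //; exact: mksq.
- by apply: emeasurable_funM => //; exact: mksq.
near=> x => _.
have h1x : 0 < fine (h1 x) by apply: hfine_gt0; near: x.
have h2x : 0 < fine (h2 x) by apply: hfine_gt0; near: x.
have k1x : 0 < k1 x by rewrite normr_gt0 gt_eqF.
have k2x : 0 < k2 x by rewrite normr_gt0 gt_eqF.
(* min(1, r^2) <= r for r >= 0: use r^2 <= r when r <= 1, and the bound 1 otherwise. *)
have s_le : s x <= r x.
  have r0 : 0 <= r x by rewrite rE divr_ge0// ltW.
  have [r1|/ltW r1] := leP (r x) 1; rewrite ge_min ?r1//.
  by rewrite expr2 ler_piMr ?orbT.
rewrite -!EFinM lee_fin /v powR_inv1 ?normr_ge0// normrM /w normrM -/(k2 x).
rewrite -/(k1 x) [`|_^-1|]gtr0_norm ?invr_gt0//.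
(* From |v| = k2 |u| / k1 one gets |v| k1^2 = |u| k1 k2 = |u| r k2^2, leaving only s <= r to
   compare. *)
rewrite [leRHS](_ : _ = `|u x| * (`|g x| * r x) * k2 x ^+ 2).
  by rewrite ler_wpM2r ?sqr_ge0// !ler_wpM2l.
by rewrite rE; field; rewrite !gt_eqF.
Unshelve. all: by end_near. Qed.

End h_transform_transience.

(** * Application to the closure of the perturbed form *)

Theorem lemma2p10 (d : measure_display) (R : realType)
    (E : borelMetricType d R)
    (E_lc : locally_compact [set: E]) (E_sep : separable E)
    (m : {measure set E -> \bar R})
    (m_radon : radon m) (m_full : full_support m)
    (F : bilform E R) (P : R -> (E -> R) -> (E -> R))
    (F_dirichlet : dirichlet_form m F) (F_regular : regular m F)
    (P_semigroup : semigroup_of m F P) (F_irreducible : irreducible m P)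
    (F_transient : transient m F)
    (mu : {measure set E -> \bar R})
    (mu_radon : radon mu) (mu_smooth : smooth m F mu)
    (Fmu_nonneg : nonneg_form (perturbed_form F mu))
    (Fmu_closable : closable m (perturbed_form F mu))
    (Pmu : R -> (E -> R) -> (E -> R))
    (Pmu_semigroup :
       semigroup_of m (form_closure m (perturbed_form F mu)) Pmu)
    (Hplus_neq0 : Hplus m Pmu !=set0) :
  let Fmu := form_closure m (perturbed_form F mu) in
  (exists2 h, Hplus m Pmu h & transient (hsq_measure m h) (h_form m h Fmu)) ->
  forall h, Hplus m Pmu h -> transient (hsq_measure m h) (h_form m h Fmu).
Proof.
move=> Fmu [h1 [h1_gt0 _] h1_transient] h [h_gt0 _].
have [_ [dom_L2 _] _ _ _] := F_dirichlet.
have Fmu_L2 u : dom Fmu u -> u \in Lfun m 2%:E by case=> u_ [].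
apply: transient_h_form h1_gt0 h_gt0 h1_transient => // u v du vL2 uv.
(* The domain of [perturbed_form] lies in [dom F], hence in L2(m). *)
apply: (form_closure_ae _ (Fmu_L2 _ du) vL2 uv du) => w [dw _].
exact: dom_L2.
Qed.
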